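(* Let $C_3=\{(x,y,z)\in\mathbb{E}^3: |x|+|y|+|z|\le 2\}$ be the regular octahedron, and let $X\subset\mathbb{E}^3$ be a discrete set of points such that $C_3+X$ is a translative covering of $\mathbb{E}^3$, i.e. $\bigcup_{\mathbf{x}\in X}(C_3+\mathbf{x})=\mathbb{E}^3$. Then the density of the covering $C_3+X$ is at least $1+\frac{4}{6^{10}}$. In other words, $$\theta^t(C_3)\ \geq\ 1+\frac{4}{6^{10}}\ >\ 1+6.6\times10^{-8}.$$
   Context: $\mathbb{E}^3$ is Euclidean 3-space. $C_3$ is the regular octahedron with vertices $(\pm2,0,0),(0,\pm2,0),(0,0,\pm2)$; its edge length is $2\sqrt2$ and its volume is $\frac{32}{3}$. For a set $X\subset\mathbb{E}^3$, $C_3+X$ denotes the family of translates $\{C_3+\mathbf{x}:\mathbf{x}\in X\}$. A set $X$ is discrete here in the sense that every bounded region contains only finitely many points of $X$. The density of a translative covering $C_3+X$ is the (lower) density $$\liminf_{r\to\infty}\frac{1}{(2r)^3}\sum_{\mathbf{x}\in X,\ (C_3+\mathbf{x})\cap[-r,r]^3\neq\varnothing}vol(C_3+\mathbf{x}),$$ where $vol(\cdot)$ denotes volume. The translative covering density $\theta^t(C_3)$ is the density of the thinnest translative covering of $\mathbb{E}^3$ by $C_3$, i.e. the infimum of the densities of $C_3+X$ over all discrete $X$ such that $C_3+X$ covers $\mathbb{E}^3$. (The quantity $\theta^t$ is invariant under non-singular linear transformations of the body.) *)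

(* Defs.v *)
From HB Require Import structures.
From mathcomp Require Import all_boot all_order all_algebra.
From mathcomp Require Import all_classical all_reals all_analysis.

Set Implicit Arguments.
Unset Strict Implicit.
Unset Printing Implicit Defensive.
Import Order.TTheory GRing.Theory Num.Theory.
Import numFieldNormedType.Exports.
Local Open Scope classical_set_scope.
Local Open Scope ring_scope.

(* The library's norm on a product is the sup norm; boundedness (the only way
   the norm is used here) is the same as for the Euclidean norm. *)
Notation E3 R := (R * R * R)%type.

Section translative_coverings.
Variable R : realType.
Implicit Types (K X : set (E3 R)) (x : E3 R) (r : R).

(* The iterated product measure is defined on the product sigma-algebra (the
   Borel sets); outside of it the value has no meaning. *)
Definition vol K : \bar R :=
  ((lebesgue_measure \x lebesgue_measure) \x lebesgue_measure)%E K.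

Definition translate K x : set (E3 R) := [set c + x | c in K].

Definition cube r : set (E3 R) := `[- r, r] `*` `[- r, r] `*` `[- r, r].

(* Locally finite, which is stronger than being discrete as a subspace. *)
Definition discrete_set X : Prop :=
  forall B : set (E3 R), bounded_set B -> finite_set (X `&` B).

Definition translative_covering K X : Prop :=
  \bigcup_(x in X) translate K x = setT.

Definition covering_density K X : \bar R :=
  limf_einf (fun r : R =>
    ((2 * r) ^- 3)%:E *
      \esum_(x in [set x | X x /\ translate K x `&` cube r !=set0])
        vol (translate K x))%E (pinfty_nbhs R).

Definition translative_covering_density K : \bar R :=
  ereal_inf [set covering_density K X | X in
    [set X | discrete_set X /\ translative_covering K X]].

Definition C3 : set (E3 R) :=
  [set p | `|p.1.1| + `|p.1.2| + `|p.2| <= 2].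

End translative_coverings.

Arguments C3 R : clear implicits.

(* Main.v *)
Require Import Defs.
From HB Require Import structures.
From mathcomp Require Import all_boot all_order all_algebra.
From mathcomp Require Import all_classical all_reals all_analysis.
From mathcomp Require Import measurable_realfun ring lra.
Set Implicit Arguments.
Unset Strict Implicit.
Unset Printing Implicit Defensive.
Import Order.TTheory GRing.Theory Num.Theory.
Import numFieldNormedType.Exports.
Local Open Scope classical_set_scope.
Local Open Scope ring_scope.

(** The octahedron is the ball of radius 2 for the l1 distance, so a covering
    by its translates is a set X of centres such that every point is within
    distance 2 of X, and two translates overlap in a body of definite size as
    soon as their centres are at distance at most 4 - 1/8 (two balls of radius
    2 have disjoint interiors exactly when this distance is at least 4).
    The heart of the matter is that such a close pair exists near every point
    (close_pair_near).

    The reason is that a face of the octahedron cannot be matched. Let 0 be a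
    centre, let q be a point just outside its face in the positive orthant,
    and let x be a centre covering q. If x is not close to 0, the translate at
    x must touch the one at 0 along that face, which forces x >= q up to a
    small error, with coordinate sum about 4 (touching_translate). In the
    plane of the face, the translate at x then cuts out the triangle of the
    points that are <= x coordinatewise; it is congruent to the opposite of
    the face. Disjoint triangles of this one orientation do not cover the
    face. Indeed, start with the triangle of a translate x covering the
    centroid of the face, and let x1 be its smallest coordinate, so that the
    face continues beyond the edge of this triangle where the first coordinate
    equals x1. A triangle that covers a point q just beyond that edge, and
    does not overlap the triangle of x, can only do so with its vertex near q
    (pointed_neighbour). Two points near each other along the edge therefore
    require two different translates whose vertices almost coincide, and these
    form a close pair (close_pair_of_min). All inequalities have room to
    spare, which is what makes the argument quantitative.

    Two translates with a close pair of centres both contain a cube of side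
    1/24 (overlap_box). Everything takes place in a bounded region, so every
    cube of side at least 9 contains such a doubly covered small cube. The
    cube [-r, r]^3 splits into equal cells of side s between 9 and 10. In each
    cell the volumes of the traces of the translates add up to at least
    s^3 + (1/24)^3 (double_cover_measure). Summing over the cells gives a
    density of at least 1 + 1/(24 s)^3 >= 1 + 1/240^3 > 1 + 4/6^10 for every
    r > 45. *)

(** * Close pairs of centres *)

Section ClosePairs.
Variable R : realType.
Implicit Types (X : set (E3 R)) (p q x y : E3 R).

Definition dist1 p q : R :=
  `|p.1.1 - q.1.1| + `|p.1.2 - q.1.2| + `|p.2 - q.2|.

Definition coords_in (a b : R) p : Prop :=
  [/\ a <= p.1.1 <= b, a <= p.1.2 <= b & a <= p.2 <= b].

(** The bound on [x + y], twice the midpoint of the pair, locates the overlap of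
    the two translates relative to the origin. *)
Definition close_pair X : Prop := exists x y,
  [/\ X x, X y, x <> y, dist1 x y <= 4 - 1 / 8 & coords_in (- 2) 7 (x + y)].

Lemma dist1_addl (z : E3 R) p q : dist1 (z + p) (z + q) = dist1 p q.
Proof.
have cancel_z (a b c : R) : a + b - (a + c) = b - c by ring.
by rewrite /dist1 /= !cancel_z.
Qed.

Definition covers X : Prop := forall p, exists2 x, X x & dist1 p x <= 2.

Lemma norm_cases (a : R) : (0 <= a /\ `|a| = a) \/ (a <= 0 /\ `|a| = - a).
Proof.
case: (lerP 0 a) => h; first by left; rewrite ger0_norm.
by right; rewrite ltr0_norm ?ltW.
Qed.

(** Since [q] has l1 norm [2 + 1/100], a centre [x] at distance at most 2 from
    [q] has norm at most [4 + 1/100], and a coordinate [x_i = q_i - t] with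
    [t >= 0] lowers this bound by twice the minimum of [t] and [q_i]. In the
    absence of close pairs the norm of [x] exceeds [4 - 1/8], so this minimum is
    less than [(1/8 + 1/100) / 2 = 27/400]. It is [t], because [q_i] is at least
    [1/10]. *)
Lemma touching_translate X q :
  covers X -> X (0, 0, 0) -> ~ close_pair X ->
  coords_in (1 / 10) (3 / 2) q -> q.1.1 + q.1.2 + q.2 = 2 + 1 / 100 ->
  exists x, [/\ X x, dist1 q x <= 2, coords_in 0 (7 / 2) x,
    [/\ q.1.1 - 27 / 400 <= x.1.1, q.1.2 - 27 / 400 <= x.1.2 &
        q.2 - 27 / 400 <= x.2] &
    4 - 1 / 8 <= x.1.1 + x.1.2 + x.2 <= 4 + 1 / 100].
Proof.
move=> cov X0 nclose; case: q => -[q1 q2] q3 [/= q1b q2b q3b] qE.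
have [[[x1 x2] x3] Xx] := cov (q1, q2, q3); rewrite /dist1 /= => qx.
exists (x1, x2, x3).
have far : 4 - 1 / 8 < `|x1| + `|x2| + `|x3|.
  rewrite ltNge; apply/negP => near; apply: nclose.
  exists (x1, x2, x3), (0, 0, 0); split=> //.
  - by case=> x10 x20 x30; move: qx; rewrite x10 x20 x30 !subr0 !ger0_norm; lra.
  - by rewrite /dist1 /= !subr0.
  - move: qx q1b q2b q3b; rewrite /coords_in /= !addr0; clear => qx q1b q2b q3b.
    have := norm_cases (q1 - x1); have := norm_cases (q2 - x2).
    by have := norm_cases (q3 - x3); split; lra.
have loss (a b : R) : 1 / 10 <= a ->
    `|b| <= a + `|a - b| /\
    (b < a - 27 / 400 -> `|b| < a + `|a - b| - 27 / 200).
  clear.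
  by have := norm_cases (a - b); have := norm_cases b; lra.
have [|w1 l1] := loss q1 x1; first by case/andP: q1b.
have [|w2 l2] := loss q2 x2; first by case/andP: q2b.
have [|w3 l3] := loss q3 x3; first by case/andP: q3b.
have x1q : q1 - 27 / 400 <= x1
  by rewrite leNgt; apply/negP => /l1; move: w1 w2 w3 far qx qE; clear; lra.
have x2q : q2 - 27 / 400 <= x2
  by rewrite leNgt; apply/negP => /l2; move: w1 w2 w3 far qx qE; clear; lra.
have x3q : q3 - 27 / 400 <= x3
  by rewrite leNgt; apply/negP => /l3; move: w1 w2 w3 far qx qE; clear; lra.
rewrite !ger0_norm in far; [|by move: x1q x2q x3q q1b q2b q3b; clear; lra..].
clear l1 l2 l3 w1 w2 w3 loss nclose.
have x1q' := ler_norm (x1 - q1); have x2q' := ler_norm (x2 - q2).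
have x3q' := ler_norm (x3 - q3); move: qx.
rewrite /dist1 /coords_in /= ![`|q1 - _|]distrC ![`|q2 - _|]distrC.
rewrite ![`|q3 - _|]distrC => qx.
have n1 := normr_ge0 (x1 - q1); have n2 := normr_ge0 (x2 - q2).
have n3 := normr_ge0 (x3 - q3).
split=> //; last by lra.
by split; apply/andP; split; lra.
Qed.

(** Let [x] touch the translate at the origin and let [q] lie on the common face
    plane, just beyond the edge of the contact triangle of [x] on which the
    first coordinate is constant, and away from the ends of that edge. Since
    the translates at [x] and [y] hardly overlap, the coordinatewise minimum of
    [x] and [y] has a sum of at most about 2; its first coordinate is that of
    [x], so the other two can hardly exceed those of [q]. Hence the contact
    triangle of [y] has a vertex near [q] and points away from that of [x].
    With the tolerance [27/400] of [touching_translate], the point [q] is more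
    than [27/400] beyond the edge and more than [3 * 27/400 = 81/400] away from
    its ends. *)
Lemma pointed_neighbour X x q :
  covers X -> X (0, 0, 0) -> ~ close_pair X -> X x ->
  coords_in (3 / 5) 3 x ->
  4 - 1 / 8 <= x.1.1 + x.1.2 + x.2 <= 4 + 1 / 100 ->
  coords_in (1 / 10) (3 / 2) q -> q.1.1 + q.1.2 + q.2 = 2 + 1 / 100 ->
  q.1.1 = x.1.1 + 7 / 100 -> q.1.2 <= x.1.2 - 21 / 100 ->
  q.2 <= x.2 - 21 / 100 ->
  exists y, [/\ X y, coords_in 0 (7 / 2) y,
    - (27 / 400) <= y.1.2 - q.1.2 <= 81 / 400,
    - (27 / 400) <= y.2 - q.2 <= 81 / 400 &
    4 - 1 / 8 <= y.1.1 + y.1.2 + y.2 <= 4 + 1 / 100].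
Proof.
move=> cov X0 nclose Xx xb xs qb qs.
have [y [Xy qy yb yq ys]] := touching_translate cov X0 nclose qb qs.
move=> q1E q2x q3x; exists y.
have far : 4 - 1 / 8 < dist1 x y.
  rewrite ltNge; apply/negP => near; apply: nclose; exists x, y; split=> //.
    (* as [7/100] exceeds [27/400], [q] is outside the translate at [x] *)
    move=> xy; move: qy q1E q2x q3x xs qs.
    rewrite -xy /dist1; clear.
    have := ler_norm (q.1.1 - x.1.1); have := ler_norm (x.1.2 - q.1.2).
    have := ler_norm (x.2 - q.2); rewrite ![`|q.1.2 - _|]distrC.
    by rewrite ![`|q.2 - _|]distrC; lra.
  by move: xb yb; clear => -[? ? ?] [? ? ?]; split=> /=; lra.
case: yq => y1q y2q y3q; split=> //.
  move: far xs ys q1E q2x q3x qs y1q y2q y3q; rewrite /dist1; clear.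
  have := norm_cases (x.1.1 - y.1.1); have := norm_cases (x.1.2 - y.1.2).
  by have := norm_cases (x.2 - y.2); lra.
move: far xs ys q1E q2x q3x qs y1q y2q y3q; rewrite /dist1; clear.
have := norm_cases (x.1.1 - y.1.1); have := norm_cases (x.1.2 - y.1.2).
by have := norm_cases (x.2 - y.2); lra.
Qed.

(** The translates covering two points at offset [28/100] along the edge of the
    contact triangle of [x] are different: the second coordinate of each centre
    differs from that of its point by an amount in an interval of length
    [108/400], less than the offset. Yet these centres are far less than 4 apart,
    by the position of the vertices of their contact triangles. The assumption
    that the first coordinate is the smallest makes the edge long enough to hold
    both points away from its ends. *)
Lemma close_pair_of_min X x :
  covers X -> X (0, 0, 0) -> X x ->
  x.1.1 <= x.1.2 -> x.1.1 <= x.2 ->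
  3 / 5 <= x.1.1 ->
  4 - 1 / 8 <= x.1.1 + x.1.2 + x.2 <= 4 + 1 / 100 ->
  close_pair X.
Proof.
case: x => -[x1 x2] x3 /= cov X0 Xx x12 x13 x1ge xs.
apply: contrapT => nclose.
have xb : coords_in (3 / 5) 3 (x1, x2, x3) by split=> /=; lra.
(* [w] is the sum of the last two coordinates on the line just beyond the edge;
   [t] and [t + 28/100] are the second coordinates of the two points. *)
pose w := 2 + 1 / 100 - x1 - 7 / 100.
have [t [t1 t2 t3 t4]] : exists t, [/\ 1 / 10 <= t, w + 21 / 100 - x3 <= t,
   t <= x2 - 49 / 100 & t <= w - 38 / 100].
  rewrite /w; have [le|gt] := lerP (1 / 10) (w + 21 / 100 - x3); last first.
    by exists (1 / 10); rewrite /w in gt *; split; lra.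
  by exists (w + 21 / 100 - x3); rewrite /w in le *; split; lra.
rewrite /w in t2 t4.
pose q u : E3 R := (x1 + 7 / 100, u, w - u).
have [y [Xy yb y2 y3 ys]] : exists y, [/\ X y, coords_in 0 (7 / 2) y,
    - (27 / 400) <= y.1.2 - (q t).1.2 <= 81 / 400,
    - (27 / 400) <= y.2 - (q t).2 <= 81 / 400 &
    4 - 1 / 8 <= y.1.1 + y.1.2 + y.2 <= 4 + 1 / 100].
  apply: (pointed_neighbour cov X0 nclose Xx xb xs);
    move: x1ge xs x12 x13 t1 t2 t3 t4; rewrite /q /w /=; clear => *;
    by [split=> /=; lra|lra].
have [z [Xz zb z2 z3 zs]] : exists y, [/\ X y, coords_in 0 (7 / 2) y,
    - (27 / 400) <= y.1.2 - (q (t + 28 / 100)).1.2 <= 81 / 400,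
    - (27 / 400) <= y.2 - (q (t + 28 / 100)).2 <= 81 / 400 &
    4 - 1 / 8 <= y.1.1 + y.1.2 + y.2 <= 4 + 1 / 100].
  apply: (pointed_neighbour cov X0 nclose Xx xb xs);
    move: x1ge xs x12 x13 t1 t2 t3 t4; rewrite /q /w /=; clear => *;
    by [split=> /=; lra|lra].
apply: nclose; exists y, z; rewrite /q /w /= in y2 y3 z2 z3; split=> //.
- by move=> yz; move: y2 z2; rewrite yz; clear; lra.
- move: y2 y3 z2 z3 ys zs; rewrite /dist1; clear.
  have := norm_cases (y.1.1 - z.1.1).
  have := norm_cases (y.1.2 - z.1.2); have := norm_cases (y.2 - z.2).
  by lra.
- by move: yb zb; clear => -[? ? ?] [? ? ?]; split=> /=; lra.
Qed.

(** The centroid of the face in the positive orthant is covered by a translate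
    whose smallest coordinate becomes the first one after exchanging two axes, a
    symmetry of the octahedron. *)
Lemma close_pair_at_origin X : covers X -> X (0, 0, 0) -> close_pair X.
Proof.
move=> cov X0; apply: contrapT => nclose.
(* three times [67/100] is [2 + 1/100] *)
pose c : R := 67 / 100.
have [||[[x1 x2] x3]] := @touching_translate X (c, c, c) cov X0 nclose.
- by rewrite /c; split=> /=; lra.
- by rewrite /c /=; lra.
rewrite /= /c => -[Xx _ _ [x1c x2c x3c] xs].
have close_preim (f : E3 R -> E3 R) :
    involutive f -> f (0, 0, 0) = (0, 0, 0) ->
    (forall p q, dist1 (f p) (f q) = dist1 p q) ->
    (forall p q, coords_in (- 2) 7 (p + q) -> coords_in (- 2) 7 (f p + f q)) ->
    ~ [/\ (f (x1, x2, x3)).1.1 <= (f (x1, x2, x3)).1.2,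
      (f (x1, x2, x3)).1.1 <= (f (x1, x2, x3)).2,
      3 / 5 <= (f (x1, x2, x3)).1.1 &
      4 - 1 / 8 <= (f (x1, x2, x3)).1.1 + (f (x1, x2, x3)).1.2 +
        (f (x1, x2, x3)).2 <= 4 + 1 / 100].
  move=> fK f0 fd fb [f12 f13 f1 fs]; apply: nclose.
  have covf : covers (f @^-1` X).
    move=> p; have [x Xfx px] := cov (f p).
    by exists (f x); rewrite /= ?fK // -fd fK.
  have [||x [y [Xfx Xfy xy dxy bxy]]] :=
    close_pair_of_min covf _ _ f12 f13 f1 fs.
  - by rewrite /= f0.
  - by rewrite /= fK.
  exists (f x), (f y); split; rewrite ?fd //; last exact: fb.
  by move/(inv_inj fK).
have : ~ (x1 <= x2 /\ x1 <= x3).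
  by case=> ? ?; apply: (close_preim id) => //; split=> //=; lra.
have : ~ (x2 <= x1 /\ x2 <= x3).
  case=> ? ?; apply: (close_preim (fun p => (p.1.2, p.1.1, p.2))) => //=.
  - by move=> [[? ?] ?].
  - by move=> p q; rewrite /dist1 /=; ring.
  - by move=> p q [].
  - by split=> //=; lra.
have : ~ (x3 <= x1 /\ x3 <= x2).
  case=> ? ?; apply: (close_preim (fun p => (p.2, p.1.2, p.1.1))) => //=.
  - by move=> [[? ?] ?].
  - by move=> p q; rewrite /dist1 /=; ring.
  - by move=> p q [].
  - by split=> //=; lra.
have [|] := leP x1 x2; have [|] := leP x1 x3; have [|] := leP x2 x3.
all: by move=> a b c'; tauto || (move: a b c'; clear; lra).
Qed.

(** Seen from a centre that covers [z], twice the midpoint of a close pair has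
    coordinates between [-2] and [7]; that centre differs from [z] by at most 2
    in each coordinate. *)
Lemma close_pair_near X (z : E3 R) : covers X -> exists a b,
  [/\ X a, X b, a <> b, dist1 a b <= 4 - 1 / 8 &
      coords_in (- 6) 11 (a + b - (z + z))].
Proof.
move=> cov; have [x0 Xx0 zx0] := cov z.
have cov0 : covers [set p | X (x0 + p)].
  move=> p; have [x Xx px] := cov (x0 + p).
  exists (x - x0); first by rewrite /= addrC subrK.
  by rewrite -(dist1_addl x0) [x0 + (x - x0)]addrC subrK.
have [|x [y [Xx Xy xy dxy bxy]]] := close_pair_at_origin cov0.
  by rewrite /= (_ : (0, 0, 0) = 0)// addr0.
exists (x0 + x), (x0 + y); split=> //.
- by move/addrI.
- by rewrite dist1_addl.
- move: zx0 bxy; rewrite /dist1 /coords_in /=.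
  have := ler_norm (z.1.1 - x0.1.1); have := ler_norm (x0.1.1 - z.1.1).
  have := ler_norm (z.1.2 - x0.1.2); have := ler_norm (x0.1.2 - z.1.2).
  have := ler_norm (z.2 - x0.2); have := ler_norm (x0.2 - z.2).
  rewrite ![`|x0.1.1 - _|]distrC ![`|x0.1.2 - _|]distrC ![`|x0.2 - _|]distrC.
  by move=> ? ? ? ? ? ? ? [? ? ?]; split; lra.
Qed.

End ClosePairs.

(** * Sums of measures of overlapping sets *)

Section Multiplicity.
Local Open Scope ereal_scope.
Context d (T : measurableType d) (R : realType).
Variable mu : {measure set T -> \bar R}.

(** Removing the doubly covered part [D] from [A a] leaves a covering of [B], to
    which subadditivity applies. *)
Lemma double_cover_measure (I : choiceType) (S : set I) (A : I -> set T)
    (B D : set T) (a b : I) :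
  finite_set S -> (forall i, S i -> measurable (A i)) ->
  measurable B -> measurable D -> B `<=` \bigcup_(i in S) A i ->
  S a -> S b -> a <> b -> D `<=` B `&` (A a `&` A b) ->
  mu B + mu D <= \sum_(i \in S) mu (A i `&` B).
Proof.
move=> finS mA mB mD Bcov Sa Sb ab DAB.
pose A' i := if i == a then (A a `&` B) `\` D else A i `&` B.
have mAB i : S i -> measurable (A i `&` B).
  by move=> Si; apply: measurableI => //; exact: mA.
have mA' i : S i -> measurable (A' i).
  move=> Si; rewrite /A'; case: ifPn => _; last exact: mAB.
  by apply: measurableD => //; exact: mAB.
have : mu B <= \sum_(i \in S) mu (A' i).
  apply: content_sub_fsum => // p Bp; have [Dp|nDp] := pselect (D p).
    exists b => //; rewrite /A' ifN; last by apply/eqP => /esym.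
    by case: (DAB _ Dp) => ? [].
  have [i Si Aip] := Bcov _ Bp; exists i => //; rewrite /A'; case: ifPn => //.
  by move/eqP => ia; split=> //; split=> //; rewrite -ia.
rewrite (fsbigD1 a)//= (fsbigD1 a S (fun i => mu (A i `&` B)))//=.
have -> : mu (A a `&` B) = mu (A' a) + mu D.
  rewrite /A' eqxx -measureU//; last by apply/seteqP; split=> p // -[[]].
    by rewrite setUC setDUK// => p /DAB [Bp [Aap _]].
  by have := mA' _ Sa; rewrite /A' eqxx.
rewrite addeAC (_ : \sum_(i \in S `\ a) mu (A' i) =
    \sum_(i \in S `\ a) mu (A i `&` B)); first by move=> ?; exact: leeD.
by apply: eq_fsbigr => i; rewrite inE => -[_ /eqP ia]; rewrite /A' ifN.
Qed.

Lemma sum_measure_ge_cells (I : choiceType) (S : set I) (A : I -> set T)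
    (K : finType) (B : K -> set T) (c : \bar R) :
  finite_set S -> (forall i, S i -> measurable (A i)) ->
  (forall k, measurable (B k)) -> trivIset setT B ->
  (forall k, c <= \sum_(i \in S) mu (A i `&` B k)) ->
  \sum_(k : K) c <= \sum_(i \in S) mu (A i).
Proof.
move=> finS mA mB tB cB.
have finK : finite_set [set: K] by exact: finite_finset.
have -> : \sum_(k : K) c = \sum_(k \in [set: K]) c.
  rewrite -big_enum fsbig_seq ?enum_uniq//; apply: eq_fsbigl => //=.
  by apply/seteqP; split=> k //= _; rewrite mem_enum.
apply: (@le_trans _ _ (\sum_(k \in [set: K]) \sum_(i \in S) mu (A i `&` B k))).
  apply: lee_fsum => // k _; exact: cB.
rewrite exchange_fsbig//; apply: lee_fsum => // i Si.
have mAB k : measurable (A i `&` B k) by apply: measurableI => //; exact: mA.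
rewrite -measure_fin_bigcup//.
- apply: le_measure; rewrite ?inE; last by move=> p [k _ []].
  + by apply: fin_bigcup_measurable.
  + exact: mA.
- apply/trivIsetP => k l _ _ kl.
  by rewrite setIACA (iffLR trivIsetP tB)// setI0.
Qed.

End Multiplicity.

(** * Volumes of translates and the density bound *)

Section DensityBound.
Variable R : realType.
Implicit Types (X : set (E3 R)) (p x w : E3 R) (r s : R).

(* The product sigma-algebra on the space is attached to this type. *)
Notation mE3 :=
  (measurableTypeR R * measurableTypeR R * measurableTypeR R)%type.

Lemma translate_C3 x : translate (C3 R) x = [set p | dist1 p x <= 2].
Proof.
apply/seteqP; split=> [_ [c Kc <-]|p px].
  by move: Kc; rewrite /C3 /dist1 /= !addrK.
by exists (p - x); rewrite ?subrK.
Qed.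

(** Half-open, so that the cells of a grid are disjoint. *)
Definition box (w : E3 R) (s : R) : set mE3 :=
  `[w.1.1, w.1.1 + s[ `*` `[w.1.2, w.1.2 + s[ `*` `[w.2, w.2 + s[.

Lemma boxP w s p : box w s p <-> [/\ w.1.1 <= p.1.1 < w.1.1 + s,
  w.1.2 <= p.1.2 < w.1.2 + s & w.2 <= p.2 < w.2 + s].
Proof.
by rewrite /box /= !in_itv /=; split=> [[[? ?] ?]|[? ? ?]].
Qed.

(** The small box is centred at the midpoint of a close pair: its points are
    within l1 distance [3/48 = 1/16] of the midpoint, which is within [2 - 1/16]
    of both centres. *)
Lemma overlap_box X (w : E3 R) (s : R) : covers X -> 9 <= s -> exists a b m,
  [/\ X a, X b, a <> b & box m (1 / 24) `<=` box w s `&`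
    (translate (C3 R) a `&` translate (C3 R) b)].
Proof.
move=> cov s9.
(* by [close_pair_near], the midpoint of a pair near [z] has coordinates between
   [-3] and [11/2] relative to [z]: [c] shifts this range to [1/4, 35/4], which
   leaves room for the small box inside [0, 9] *)
pose c : R := 13 / 4.
have [a [b [Xa Xb ab dab bab]]] := close_pair_near (w + (c, c, c)) cov.
exists a, b, ((a.1.1 + b.1.1) / 2 - 1 / 48, (a.1.2 + b.1.2) / 2 - 1 / 48,
  (a.2 + b.2) / 2 - 1 / 48); split=> // p /boxP /= [p1 p2 p3].
have half (u v t : R) :
    (u + v) / 2 - 1 / 48 <= t < (u + v) / 2 - 1 / 48 + 1 / 24 ->
    `|t - u| <= `|u - v| / 2 + 1 / 48 /\ `|t - v| <= `|u - v| / 2 + 1 / 48.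
  move=> tuv; have := ler_norm (u - v); have := ler_norm (v - u).
  by rewrite [`|v - u|]distrC !ler_norml => ? ?; split; lra.
have [pa1 pb1] := half _ _ _ p1; have [pa2 pb2] := half _ _ _ p2.
have [pa3 pb3] := half _ _ _ p3; rewrite /dist1 in dab.
split; last by rewrite !translate_C3; split; rewrite /dist1 /=; lra.
apply/boxP; move: bab p1 p2 p3 s9; rewrite /coords_in /c /=; clear.
by case=> ? ? ? ? ? ? ?; split; lra.
Qed.

(** The function [vol], packed as a measure. *)
Definition volume : {measure set mE3 -> \bar R} :=
  ((lebesgue_measure \x lebesgue_measure) \x lebesgue_measure)%E.

Lemma measurable_box w s : measurable (box w s).
Proof. by do 2 apply: measurableX => //. Qed.

Lemma volume_box w s : 0 < s -> volume (box w s) = (s ^+ 3)%:E.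
Proof.
move=> s0; pose I t : set (measurableTypeR R) := [set` `[t, t + s[].
have mI t : measurable (I t) by exact: measurable_itv.
pose area : {measure set (measurableTypeR R * measurableTypeR R) -> \bar R} :=
  (lebesgue_measure \x lebesgue_measure)%E.
have -> : volume (box w s) =
    (area (I w.1.1 `*` I w.1.2) * lebesgue_measure (I w.2))%E.
  by apply: product_measure1E => //; exact: measurableX.
have -> : area (I w.1.1 `*` I w.1.2) =
    (lebesgue_measure (I w.1.1) * lebesgue_measure (I w.1.2))%E.
  exact: product_measure1E.
rewrite /I !lebesgue_measure_itv /= !lte_fin !ltrDl s0 -!EFinB -!EFinM.
by congr EFin; ring.
Qed.

Lemma measurable_translate_C3 x : measurable (translate (C3 R) x : set mE3).
Proof.
rewrite translate_C3.
have -> : [set p | dist1 p x <= 2] =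
    (fun p => dist1 p x) @^-1` [set` `]-oo, 2]].
  by apply/seteqP; split=> p /=; rewrite in_itv.
rewrite -[X in measurable X]setTI.
suff : measurable_fun [set: mE3]
  (fun p : mE3 => dist1 p x : measurableTypeR R) by exact.
have m (f : mE3 -> measurableTypeR R) (a : R) : measurable_fun setT f ->
    measurable_fun setT (fun p => `|f p - a| : measurableTypeR R).
  by move=> mf; apply: measurableT_comp => //; exact: measurable_funB.
by do 2 ?apply: measurable_funD; apply: m => //; exact: measurableT_comp.
Qed.

Lemma finite_touching X r : discrete_set X ->
  finite_set [set x | X x /\ translate (C3 R) x `&` cube r !=set0].
Proof.
move=> dX; apply: dX; exists (r + 2); split; first exact: num_real.
move=> M rM x /= [p []]; rewrite translate_C3 /dist1 /cube /= !in_itv /=.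
move=> px [[p1 p2] p3].
have := ler_norm (p.1.1 - x.1.1); have := ler_norm (x.1.1 - p.1.1).
have := ler_norm (p.1.2 - x.1.2); have := ler_norm (x.1.2 - p.1.2).
have := ler_norm (p.2 - x.2); have := ler_norm (x.2 - p.2).
rewrite ![`|x.1.1 - _|]distrC ![`|x.1.2 - _|]distrC ![`|x.2 - _|]distrC.
move=> ? ? ? ? ? ?.
rewrite !prod_normE !ge_max !ler_norml -!andbA.
by do 5 ?[apply/andP; split]; lra.
Qed.

(** The cube is cut into [n ^ 3] cells of side [2 * r / n], and each of them
    contains a doubly covered box. *)
Lemma volume_touching X (n : nat) r : discrete_set X -> covers X ->
  9 * n%:R <= 2 * r -> (0 < n)%N ->
  ((((2 * r / n%:R) ^+ 3 + (1 / 24) ^+ 3) *+ (n ^ 3))%:E <=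
  \esum_(x in [set x | X x /\ translate (C3 R) x `&` cube r !=set0])
    vol (translate (C3 R) x))%E.
Proof.
move=> dX cov rn n0; have finS := finite_touching r dX; rewrite esum_fset//.
set s := 2 * r / n%:R.
have s9 : 9 <= s by rewrite /s ler_pdivlMr ?ltr0n.
have ns : n%:R * s = 2 * r by rewrite /s mulrC divfK// pnatr_eq0 -lt0n.
pose corner (k : 'I_n * 'I_n * 'I_n) : E3 R :=
  (- r + k.1.1%:R * s, - r + k.1.2%:R * s, - r + k.2%:R * s).
have cell_in (i : 'I_n) t : - r + i%:R * s <= t < - r + i%:R * s + s ->
    - r <= t <= r.
  have i0 : 0 <= i%:R * s by apply: mulr_ge0 => //; lra.
  have : i.+1%:R * s <= n%:R * s by apply: ler_wpM2r; [lra|rewrite ler_nat].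
  by rewrite -natr1 ns; lra.
have cell_lt (i j : 'I_n) t : - r + i%:R * s <= t < - r + i%:R * s + s ->
    - r + j%:R * s <= t < - r + j%:R * s + s -> ~ (i < j)%N.
  move=> ti tj ij; have : i.+1%:R * s <= j%:R * s.
    by apply: ler_wpM2r; [lra|rewrite ler_nat].
  by rewrite -natr1; lra.
have cell_inj (i j : 'I_n) t : - r + i%:R * s <= t < - r + i%:R * s + s ->
    - r + j%:R * s <= t < - r + j%:R * s + s -> i = j.
  move=> ti tj; apply: val_inj => /=; case: (ltngtP i j) => //.
    by move/(cell_lt _ _ _ ti tj).
  by move/(cell_lt _ _ _ tj ti).
have cell_cube k p : box (corner k) s p -> cube r p.
  case/boxP => /cell_in ? /cell_in ? /cell_in ?.
  by rewrite /cube /= !in_itv /=.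
have -> : (((s ^+ 3 + (1 / 24) ^+ 3) *+ (n ^ 3))%:E =
    \sum_(k : 'I_n * 'I_n * 'I_n) (s ^+ 3 + (1 / 24) ^+ 3)%:E)%E.
  by rewrite sumEFin sumr_const !card_prod card_ord -mulnA.
apply: (@sum_measure_ge_cells _ _ _ volume _ _ (fun x => translate (C3 R) x)
  _ (fun k => box (corner k) s)) => //.
- by move=> x _; exact: measurable_translate_C3.
- by move=> k; exact: measurable_box.
- apply/trivIsetP => -[[i1 i2] i3] [[j1 j2] j3] _ _ ij.
  apply/seteqP; split=> p // -[/boxP[/= i1p i2p i3p] /boxP[/= j1p j2p j3p]].
  move/eqP: ij; case.
  by rewrite (cell_inj _ _ _ i1p j1p) (cell_inj _ _ _ i2p j2p)
    (cell_inj _ _ _ i3p j3p).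
- move=> k; have [a [b [m [Xa Xb ab Dab]]]] := overlap_box (corner k) cov s9.
  have mD : box m (1 / 24) m by apply/boxP; split; lra.
  rewrite EFinD -(volume_box (corner k)); last by lra.
  rewrite -(volume_box m); last by lra.
  apply: (@double_cover_measure _ _ _ volume _ _
    (fun x => translate (C3 R) x) _ _ a b) => //.
  + by move=> x _; exact: measurable_translate_C3.
  + exact: measurable_box.
  + exact: measurable_box.
  + move=> p pk; have [x Xx px] := cov p.
    have Kxp : translate (C3 R) x p by rewrite translate_C3.
    by exists x => //; split=> //; exists p; split=> //; exact: cell_cube pk.
  + split=> //; exists m; have [? []] := Dab _ mD.
    by split=> //; apply: cell_cube; eassumption.
  + split=> //; exists m; have [? []] := Dab _ mD.
    by split=> //; apply: cell_cube; eassumption.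
Qed.

Lemma covering_density_ge X : discrete_set X -> translative_covering (C3 R) X ->
  ((1 + 4 / 6 ^+ 10)%:E <= covering_density (C3 R) X)%E.
Proof.
move=> dX tX; have cov : covers X.
  move=> p; have : [set: E3 R] p by [].
  by rewrite -tX => -[x Xx]; rewrite translate_C3; exists x.
rewrite /covering_density limf_einfE.
apply: le_trans (ereal_sup_ubound _); last first.
  by exists [set r | 45 < r] => //; exists 45; split=> //; exact: num_real.
apply: le_ereal_inf_tmp => _ [r /= r45 <-].
(* cells of side between 9 and 10 *)
pose n := Num.trunc (2 * r / 9).
have /andP[nle nlt] : n%:R <= 2 * r / 9 < n.+1%:R.
  by apply: truncn_itv; lra.
have n10 : (10 <= n)%N by rewrite truncn_ge_nat; lra.
have n0 : (0 < n)%N by exact: leq_trans n10.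
have nR10 : 10 <= n%:R :> R by rewrite ler_nat.
rewrite -natr1 in nlt.
have s10 : 2 * r / n%:R <= 10 by rewrite ler_pdivrMr; lra.
have rn : 9 * n%:R <= 2 * r by lra.
apply: le_trans (lee_wpmul2l _ (volume_touching dX cov rn n0)); last first.
  by rewrite lee_fin invr_ge0 exprn_ge0//; lra.
rewrite -EFinM lee_fin -[X in _ <= _ * X]mulr_natr natrX.
have r0 : 2 * r != 0 by rewrite gt_eqF; lra.
have nR0 : n%:R != 0 :> R by rewrite gt_eqF; lra.
have -> : (2 * r) ^- 3 * (((2 * r / n%:R) ^+ 3 + (1 / 24) ^+ 3) * n%:R ^+ 3) =
    1 + (24 * (2 * r / n%:R)) ^- 3.
  by field; rewrite nR0; move: r0; rewrite mulf_eq0 => /norP[_ ->].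
rewrite lerD2l; apply: (@le_trans _ _ ((240 : R) ^- 3)); first by lra.
have s0 : 0 < 2 * r / n%:R by apply: divr_gt0; lra.
rewrite lef_pV2 ?posrE ?exprn_gt0//; first apply: lerXn2r; rewrite ?nnegrE.
all: by lra.
Qed.

End DensityBound.

Theorem theorem1p1 (R : realType) :
  (forall X : set (E3 R), discrete_set X -> translative_covering (C3 R) X ->
     ((1 + 4 / 6 ^+ 10)%:E <= covering_density (C3 R) X)%E) /\
  ((1 + 4 / 6 ^+ 10)%:E <= translative_covering_density (C3 R))%E /\
  (1 + (66 / 10) * 10 ^- 8 < 1 + 4 / 6 ^+ 10 :> R).
Proof.
split; [exact: covering_density_ge|split; last by lra].
by apply: le_ereal_inf_tmp => _ [X [dX tX] <-]; exact: covering_density_ge.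
Qed.
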